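(* For all nonnegative integers $m,n$, every eigenvalue of the adjacency matrix of the simplicial rook graph ${\rm SR}(m,n)$ is an integer.
   Context: Let $\mathbb{N}=\{0,1,2,\dots\}$. For $m,n\in\mathbb{N}$, the simplicial rook graph ${\rm SR}(m,n)$ has as vertices the vectors in $\mathbb{N}^m$ with coordinate sum $n$; two vertices are adjacent when they differ in precisely two coordinate positions. Eigenvalues of a graph are those of its adjacency matrix. *)

(* Defs.v *)
From mathcomp Require Import all_boot all_order all_algebra all_field.
Set Implicit Arguments. Unset Strict Implicit. Unset Printing Implicit Defensive.
Import GRing.Theory Num.Theory.
Local Open Scope ring_scope.

(* Vertices of SR(m,n): vectors x in N^m with coordinate sum n.
   Each coordinate is then at most n, so we represent x as a finite
   function 'I_m -> 'I_n.+1 with (nat) coordinate sum n. *)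
Definition SRvert (m n : nat) : predArgType :=
  {x : {ffun 'I_m -> 'I_n.+1} | (\sum_(i < m) (x i : nat))%N == n}.

Definition SRadj (m n : nat) (x y : SRvert m n) : bool :=
  #|[set i : 'I_m | val x i != val y i]| == 2%N.

Definition SRadjmx (m n : nat) : 'M[algC]_#|SRvert m n| :=
  \matrix_(i, j) (SRadj (enum_val i) (enum_val j))%:R.

(* Main.v *)
(* A function f on vertices is encoded by the homogeneous polynomial
   P = sum_x f(x) z^x.  Adjacency becomes sum_{i<j} (S_ij - 1), where
   S_ij P = (z_i P|_{z_j=z_i} - z_j P|_{z_i=z_j}) / (z_i - z_j).  For a colouring c of
   the coordinates, restrict P to the subspace where z is constant on the colour
   classes; the coefficient of t^e in this restriction is the sum of f over the
   vertices whose block sums are e.  If c i = c j, then the S_ij act diagonally on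
   this coefficient after summation over the pairs in the class.  If
   I = c i < J = c j, then expanding 1/(t_I - t_J) in powers of t_J/t_I expresses
   S_ij through colourings in which j moves to I or i moves to J, and through
   exponents in which mass moves from J to I.  So the operator is
   triangular for the lexicographic order on (sum_b b e_b, sum_k c k), with integer
   diagonal, and for a non-integer eigenvalue all these coefficients vanish; the
   identity colouring then gives f = 0. *)
Require Import Defs.
From mathcomp Require Import all_boot all_order all_algebra all_field.
From mathcomp Require Import zify.
Set Implicit Arguments.
Unset Strict Implicit.
Unset Printing Implicit Defensive.

Import GRing.Theory Num.Theory.
Local Open Scope ring_scope.

Section Vertices.

Variables m n : nat.
Implicit Types (x y : SRvert m n) (c : {ffun 'I_m -> 'I_m}).
Implicit Types (e : {ffun 'I_m -> 'I_n.+1}) (i j k b : 'I_m).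

(** * Coordinates and difference sets of vertices *)

Definition coord x i : nat := val x i.

Lemma coord_inj x y : (forall i, coord x i = coord y i) -> x = y.
Proof. by move=> eq_xy; apply/val_inj/ffunP => i; apply/val_inj/eq_xy. Qed.

Lemma sum_coord x : (\sum_i coord x i)%N = n.
Proof. exact/eqP/(valP x). Qed.

Lemma eq_sum_coord x y : (\sum_i coord x i = \sum_i coord y i)%N.
Proof. by rewrite !sum_coord. Qed.

Definition diffset x y : {set 'I_m} := [set i | val x i != val y i].

Lemma diffsetP x y k : reflect (coord x k = coord y k) (k \notin diffset x y).
Proof.
rewrite inE negbK; rewrite /coord; apply: (iffP eqP) => [-> //|]; exact: val_inj.
Qed.

Lemma eq_off1 x y i : (forall k, k != i -> coord x k = coord y k) -> x = y.
Proof.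
move=> eq_xy; apply: coord_inj => k; have [->|/eq_xy//] := eqVneq k i.
have := eq_sum_coord x y; rewrite (bigD1 i) //= [RHS](bigD1 i) //=.
by rewrite (eq_bigr _ eq_xy) => /addIn.
Qed.

(** * Adjacency through lines in two coordinate directions *)

Definition line i j x y := diffset x y \subset [set i; j].

Lemma lineP i j x y :
  reflect (forall k, k != i -> k != j -> coord x k = coord y k) (line i j x y).
Proof.
apply: (iffP subsetP) => [sub k ki kj|eq_xy k].
  by apply/diffsetP/negP => /sub; rewrite !inE (negPf ki) (negPf kj).
rewrite !inE => neq_k; apply: contraR neq_k; rewrite negb_or => /andP[ki kj].
by apply/eqP/val_inj/eq_xy.
Qed.

Lemma card_diffset_gt1 x y : x != y -> (1 < #|diffset x y|)%N.
Proof.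
apply: contraR; rewrite -leqNgt => /card_le1_eqP D1.
have [D0|[i iD]] := set_0Vmem (diffset x y).
  by apply/eqP/coord_inj => k; apply/diffsetP; rewrite D0 inE.
apply/eqP/(@eq_off1 _ _ i) => k ki; apply/diffsetP.
by apply: contra ki => kD; apply/eqP/D1.
Qed.

(** Equal coordinate sums forbid a difference in exactly one position. So for distinct [x], [y] the
    difference set lies in one pair if they are adjacent and in none otherwise; for [x = y] every
    summand is 1 - 1. *)
Lemma SRadjE (R : pzRingType) x y :
  (SRadj x y)%:R =
  \sum_(p : 'I_m * 'I_m | (p.1 < p.2)%N) ((line p.1 p.2 x y)%:R - (x == y)%:R) :> R.
Proof.
rewrite /SRadj -/(diffset x y); have [->|neq_xy] := eqVneq x y.
  have D0: diffset y y = set0 by apply/setP => k; rewrite !inE eqxx.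
  by rewrite D0 cards0 big1 // => p _; rewrite /line D0 sub0set subrr.
under eq_bigr do rewrite subr0.
have D2 := card_diffset_gt1 neq_xy.
have [/cards2P[a [b [neq_ab DE]]]|Dn2] := boolP (#|diffset x y| == 2)%N; last first.
  rewrite big1 // => p _; rewrite /line; case: (boolP (_ \subset _)) => //.
  move/subset_leq_card; rewrite cards2 => le_D; case/negP: Dn2.
  by rewrite eqn_leq D2 andbT (leq_trans le_D) //; case: (_ != _).
wlog lt_ab: a b neq_ab DE / (a < b)%N.
  move=> wl; have [|lt_ba|/val_inj eq_ab] := ltngtP a b; first exact: wl.
    by apply: (wl b a) => //; rewrite 1?eq_sym // setUC.
  by rewrite eq_ab eqxx in neq_ab.
rewrite (bigD1 (a, b)) //= big1 ?addr0 => [|[i j] /= /andP[lt_ij neq]].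
  by rewrite /line DE subxx.
rewrite /line DE; case: (boolP (_ \subset _)) => // /subsetP sub.
case/negP: neq; rewrite -pair_eqE /=.
have /set2P ha := sub a (set21 a b); have /set2P hb := sub b (set22 a b).
case: ha hb lt_ab lt_ij => [->|->] [->|->]; rewrite ?ltnn ?eqxx //.
by move=> h1 h2; have := ltn_trans h1 h2; rewrite ltnn.
Qed.

(** * Points of a line, indexed by one coordinate *)

Definition shift_coord y i j (t : nat) k : nat :=
  if k == i then t else if k == j then (coord y i + coord y j - t)%N else coord y k.

(** For [i != j] and [t <= coord y i + coord y j] the vector is a vertex, and no default value
    intervenes. *)
Definition shift y i j (t : nat) : SRvert m n :=
  insubd y [ffun k => inord (shift_coord y i j t k)].

Lemma sum_pair (F : 'I_m -> nat) (P : pred 'I_m) i j : i != j ->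
  (\sum_(k | P k) F k =
   P i * F i + P j * F j + \sum_(k | [&& P k, k != i & k != j]) F k)%N.
Proof.
move=> neq_ij; rewrite big_mkcond /= (bigD1 i) //= (bigD1 j) 1?eq_sym //= addnA.
congr (_ + _ + _)%N; try by case: (P _); rewrite ?mul1n ?mul0n.
by rewrite -big_mkcondr /=; apply: eq_bigl => k; rewrite andbC.
Qed.

Lemma coord_shift y i j t : i != j -> (t <= coord y i + coord y j)%N ->
  forall k, coord (shift y i j t) k = shift_coord y i j t k.
Proof.
move=> neq_ij le_t.
have sumS: (\sum_k shift_coord y i j t k)%N = n.
  rewrite -[RHS](sum_coord y) !(@sum_pair _ xpredT i j neq_ij) /= !mul1n.
  rewrite /shift_coord eqxx eq_sym (negPf neq_ij) eqxx subnKC //; congr (_ + _)%N.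
  by apply: eq_bigr => k /andP[/negPf-> /negPf->].
have leS k: (shift_coord y i j t k <= n)%N by rewrite -sumS (bigD1 k) //= leq_addr.
move=> k; rewrite /coord /shift insubdK ?ffunE ?inordK ?ltnS //.
rewrite unfold_in; apply/eqP; rewrite -[RHS]sumS; apply: eq_bigr => l _.
by rewrite ffunE inordK ?ltnS.
Qed.

Lemma line_sum i j x y : i != j -> line i j x y ->
  (coord x i + coord x j = coord y i + coord y j)%N.
Proof.
move=> neq_ij /lineP eq_xy.
have := eq_sum_coord x y; rewrite !(@sum_pair _ xpredT i j neq_ij) /= !mul1n.
rewrite (eq_bigr (coord y)) => [/addIn //|k /andP[]]; exact: eq_xy.
Qed.

Lemma sum_line (V : nmodType) i j y (F : SRvert m n -> V) : i != j ->
  \sum_(x | line i j y x) F x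
  = \sum_(t < (coord y i + coord y j).+1) F (shift y i j t).
Proof.
move=> neq_ij; have cs := @coord_shift y i j _ neq_ij.
rewrite (reindex_onto (fun t : 'I_(coord y i + coord y j).+1 => shift y i j t)
   (fun x => inord (coord x i))) /=.
  apply: eq_bigl => t; have le_t: (t <= coord y i + coord y j)%N by rewrite -ltnS.
  rewrite -val_eqE /= cs // /shift_coord eqxx inord_val eqxx andbT.
  apply/lineP => k ki kj.
  by rewrite cs // /shift_coord (negPf ki) (negPf kj).
move=> x L; have s := @line_sum i j y x neq_ij L.
have le_x: (coord x i <= coord y i + coord y j)%N by rewrite s leq_addr.
rewrite inordK ?ltnS //; apply: coord_inj => k; rewrite cs // /shift_coord.
have [->//|ki] := eqVneq k i; have [->|kj] := eqVneq k j; first by rewrite s addKn.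
by move/lineP: L => /(_ k ki kj).
Qed.

(** * Block sums, recolourings and counts along a line *)

Definition blocksum c x b : nat := (\sum_(k | c k == b) coord x k)%N.

(** The exponent of the monomial z^x after restriction to the subspace of [c]; [inord] is harmless
    since a block sum is at most [n]. *)
Definition push c x : {ffun 'I_m -> 'I_n.+1} := [ffun b => inord (blocksum c x b)].

Lemma pushE c x b : push c x b = blocksum c x b :> nat.
Proof.
rewrite ffunE inordK // ltnS -[leqRHS](sum_coord x) /blocksum.
by rewrite [leqRHS](bigID (fun k => c k == b)) /= leq_addr.
Qed.

Lemma push_eqP c x e : reflect (forall b, blocksum c x b = e b) (push c x == e).
Proof.
apply: (iffP eqP) => [<- b|eq_e]; first by rewrite pushE.
by apply/ffunP => b; apply/val_inj; rewrite /= pushE.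
Qed.

Definition rest c i j y b : nat :=
  (\sum_(k | [&& c k == b, k != i & k != j]) coord y k)%N.

Lemma blocksum_pair c i j y b : i != j ->
  blocksum c y b =
  ((c i == b) * coord y i + (c j == b) * coord y j + rest c i j y b)%N.
Proof. exact: sum_pair. Qed.

Lemma rest_line c i j x y b : line i j y x -> rest c i j x b = rest c i j y b.
Proof.
by move/lineP=> eq_xy; apply: eq_bigr => k /and3P[_ ki kj]; rewrite eq_xy.
Qed.

Lemma line_shift i j y t : i != j -> (t <= coord y i + coord y j)%N ->
  line i j y (shift y i j t).
Proof.
move=> neq_ij le_t; apply/lineP => k ki kj.
by rewrite coord_shift // /shift_coord (negPf ki) (negPf kj).
Qed.

Definition recolor c j b : {ffun 'I_m -> 'I_m} :=
  [ffun k => if k == j then b else c k].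

Lemma rest_recolorl c i j b y : rest (recolor c i b) i j y =1 rest c i j y.
Proof.
move=> b'; apply: eq_bigl => k; rewrite ffunE.
by case: (eqVneq k i) => //= _; rewrite !andbF.
Qed.

Lemma rest_recolorr c i j b y : rest (recolor c j b) i j y =1 rest c i j y.
Proof.
move=> b'; apply: eq_bigl => k; rewrite ffunE.
by case: (eqVneq k j) => //= _; rewrite !andbF.
Qed.

(** Moving mass between [i] and [j] inside one class changes no block sum, so [push c] is constant
    on the line. *)
Lemma count_line_same c e i j y : i != j -> c i = c j ->
  (\sum_(x | line i j y x) (push c x == e) =
   (coord y i + coord y j).+1 * (push c y == e))%N.
Proof.
move=> neq_ij eq_c; rewrite (@sum_line _ i j y (fun x => (push c x == e) : nat)) //.
rewrite (eq_bigr (fun=> (push c y == e) : nat)); first by rewrite sum_nat_const card_ord.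
move=> t _; congr (nat_of_bool (_ == e)); apply/ffunP => b; apply/val_inj.
have L := @line_shift i j y t neq_ij (ltn_ord t).
rewrite /= !pushE !(@blocksum_pair _ i j) // eq_c -!mulnDr (rest_line _ _ L).
by rewrite -(line_sum neq_ij L).
Qed.

(** The exponents that the expansion of 1/(t_I - t_J) can link to [e]: mass moves only between [b1]
    and [b2]. *)
Definition same_total e b1 b2 : pred {ffun 'I_m -> 'I_n.+1} := fun e' =>
  [forall b, [|| b == b1, b == b2 | e' b == e b]]
  && (e' b1 + e' b2 == e b1 + e b2)%N.

(** Either recolouring puts [i] and [j] in one class, so the condition sees only
    [coord y i + coord y j] and the other coordinates, and is the same for both. *)
Lemma same_total_push c d e i j y : i != j -> c i != c j ->
    d \in [:: recolor c j (c i); recolor c i (c j)] ->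
  same_total e (c i) (c j) (push d y) =
  [forall b, [|| b == c i, b == c j | rest c i j y b == e b]]
  && (coord y i + coord y j + (rest c i j y (c i) + rest c i j y (c j))
      == e (c i) + e (c j))%N.
Proof.
move=> neq_ij neq_c; rewrite !inE => /orP[]/eqP->; rewrite /same_total;
  congr (_ && _).
- apply: eq_forallb => b; have [//|bi] := eqVneq b (c i).
  have [//|bj] := eqVneq b (c j).
  rewrite -val_eqE /= pushE (blocksum_pair _ _ _ neq_ij) rest_recolorr !ffunE eqxx.
  by rewrite (negPf neq_ij) ![_ == b]eq_sym (negPf bi).
- rewrite !pushE !(blocksum_pair _ _ _ neq_ij) !rest_recolorr !ffunE eqxx.
  by rewrite (negPf neq_ij) (negPf neq_c) eqxx; lia.
- apply: eq_forallb => b; have [//|bi] := eqVneq b (c i).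
  have [//|bj] := eqVneq b (c j).
  rewrite -val_eqE /= pushE (blocksum_pair _ _ _ neq_ij) rest_recolorl !ffunE eqxx.
  by rewrite [j == i]eq_sym (negPf neq_ij) ![_ == b]eq_sym (negPf bj).
- rewrite !pushE !(blocksum_pair _ _ _ neq_ij) !rest_recolorl !ffunE eqxx.
  by rewrite [j == i]eq_sym (negPf neq_ij) [c j == c i]eq_sym (negPf neq_c) eqxx; lia.
Qed.

(* With r_b the sum of y over the class of colour b without i and j, at most one x on
   the line through y has block sums e.  It exists iff the totals match,
   r_I <= e_I and r_J <= e_J; since r_I > e_I forces r_J <= e_J, its indicator is
   the difference of two indicators, each depending on y through a recolouring. *)
Lemma count_line_diff c e i j y : i != j -> c i != c j ->
  (\sum_(x | line i j y x) (push c x == e) +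
   (same_total e (c i) (c j) (push (recolor c i (c j)) y)
    && (e (c i) < push (recolor c i (c j)) y (c i))) =
   (same_total e (c i) (c j) (push (recolor c j (c i)) y)
    && (push (recolor c j (c i)) y (c j) <= e (c j))))%N.
Proof.
move=> neq_ij neq_c.
rewrite !same_total_push ?inE ?eqxx ?orbT //.
rewrite !pushE !(blocksum_pair _ _ _ neq_ij) rest_recolorl rest_recolorr.
rewrite !ffunE !eqxx.
rewrite [j == i]eq_sym (negPf neq_ij) [c j == c i]eq_sym (negPf neq_c) !mul0n !add0n.
rewrite (@sum_line _ i j y (fun x => (push c x == e) : nat)) //.
set Q := [forall b, _]; set s := (coord y i + coord y j)%N.
set ri := rest _ _ _ _ (c i); set rj := rest _ _ _ _ (c j).
have pushS (t : 'I_s.+1): (push c (shift y i j t) == e) =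
    [&& Q, ri + t == e (c i) & rj + (s - t) == e (c j)]%N.
  have le_t: (t <= coord y i + coord y j)%N by rewrite -ltnS.
  have L := line_shift neq_ij le_t.
  have sE b: blocksum c (shift y i j t) b =
      ((c i == b) * t + (c j == b) * (s - t) + rest c i j y b)%N.
    rewrite (blocksum_pair _ _ _ neq_ij) (rest_line _ _ L) !coord_shift //.
    by rewrite /shift_coord eqxx [j == i]eq_sym (negPf neq_ij) eqxx.
  apply/push_eqP/and3P => [eq_e|[/forallP q /eqP eI /eqP eJ] b].
    split; [apply/forallP => b|rewrite -eq_e sE|rewrite -eq_e sE].
    - have [//|bi] := eqVneq b (c i); have [//|bj] := eqVneq b (c j).
      by rewrite -eq_e sE ![_ == b]eq_sym (negPf bi) (negPf bj) /= eqxx.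
    - by rewrite eqxx [c j == c i]eq_sym (negPf neq_c) -/ri; lia.
    - by rewrite eqxx (negPf neq_c) -/rj; lia.
  rewrite sE; have [<-|bi] := eqVneq (c i) b.
    by rewrite [c j == c i]eq_sym (negPf neq_c) -/ri; lia.
  have [<-|bj] := eqVneq (c j) b; first by rewrite -/rj; lia.
  by have := q b; rewrite ![b == _]eq_sym (negPf bi) (negPf bj) => /eqP<-.
under eq_bigr do rewrite pushS.
case: Q {pushS} => /=; last by rewrite big1.
have [tot|ntot] := eqVneq (s + (ri + rj))%N (e (c i) + e (c j))%N; last first.
  by rewrite big1 // => t _; have := ltn_ord t; lia.
have [gt|le_i] := ltnP (e (c i)) ri.
  by rewrite big1 => [|t _]; lia.
have [le_j|gt] := leqP rj (e (c j)); last first.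
  by rewrite big1 // => t _; have := ltn_ord t; lia.
(* The block sum at [c i] forces this [t]; it is at most [s] because the totals match and
   [rj <= e (c j)]. *)
have lt_t: (e (c i) - ri < s.+1)%N by lia.
rewrite (bigD1 (Ordinal lt_t)) //= big1 => [|t]; first by lia.
by rewrite -val_eqE /=; lia.
Qed.

(** * The lexicographic order and the diagonal entries *)

Definition weight e : nat := (\sum_(b < m) b * e b)%N.

Lemma weight_same_total e e' b1 b2 : b1 != b2 -> same_total e b1 b2 e' ->
  (weight e' + (b1 * e b1 + b2 * e b2) = weight e + (b1 * e' b1 + b2 * e' b2))%N.
Proof.
move=> neq_b /andP[/forallP eq_e _].
rewrite /weight !(@sum_pair _ xpredT b1 b2 neq_b) /= !mul1n.
rewrite (eq_bigr (fun b : 'I_m => b * e b)%N); first by lia.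
by move=> b /andP[n1 n2]; have := eq_e b; rewrite (negPf n1) (negPf n2) => /eqP->.
Qed.

Definition height c : nat := (\sum_k c k)%N.

Lemma height_recolor c j b : (b < c j)%N -> (height (recolor c j b) < height c)%N.
Proof.
move=> lt_b; rewrite /height (bigD1 j) //= [X in (_ < X)%N](bigD1 j) //= ffunE eqxx.
rewrite (eq_bigr (fun k => c k : nat)) ?ltn_add2r // => k /negPf nkj.
by rewrite ffunE nkj.
Qed.

(* The integer eigenvalue, up to the shift by the number of pairs i < j. *)
Definition diag c e : nat :=
  (\sum_(p : 'I_m * 'I_m | (p.1 < p.2) && (c p.1 == c p.2)) 1
   + \sum_b #|[set k | c k == b]|.-1 * e b)%N.

(** Each [i] is paired with the other members of its class, so [coord y i] is counted class size
    minus one times. Hence the diagonal entry depends on [y] only through its block sums. *)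
Lemma sum_same_pairs c y :
  (\sum_(p : 'I_m * 'I_m | (p.1 < p.2) && (c p.1 == c p.2))
     (coord y p.1 + coord y p.2).+1 = diag c (push c y))%N.
Proof.
under eq_bigr do rewrite -add1n; rewrite big_split /= /diag; congr (_ + _)%N.
(* [G] runs over ordered pairs: those with [i < j] come from the first member of each pair, the
   others from the second. *)
pose G := (\sum_i \sum_(j | (i != j) && (c i == c j)) coord y i)%N.
transitivity G.
  pose lt_same i j := (i < j)%N && (c i == c j).
  rewrite big_split /= -(pair_big_dep xpredT lt_same (fun i _ => coord y i)).
  rewrite -(pair_big_dep xpredT lt_same (fun _ j => coord y j)) /=.
  rewrite [X in (_ + X)%N](exchange_big_dep xpredT) //= -big_split /=; apply: eq_bigr => i _.
  rewrite [RHS](bigID (fun j => i < j)%N) /=; congr (_ + _)%N; apply: eq_bigl => j.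
    rewrite /lt_same -(inj_eq val_inj i j) /=.
    by case: ltngtP; rewrite ?andbT ?andbF.
  rewrite /lt_same -(inj_eq val_inj i j) [c i == _]eq_sym /=.
  by case: ltngtP; rewrite ?andbT ?andbF.
rewrite [RHS](eq_bigr (fun b =>
  \sum_(i | c i == b) #|[set k | c k == b]|.-1 * coord y i)%N).
  rewrite /G [LHS](partition_big c xpredT) //=; apply: eq_bigr => b _.
  apply: eq_bigr => i /eqP ci; rewrite sum_nat_cond_const; congr (_ * _)%N.
  rewrite [in RHS](cardsD1 i) inE ci eqxx add1n /=; apply: eq_card => k.
  by rewrite !inE [i == k]eq_sym [b == _]eq_sym.
by move=> b _; rewrite pushE /blocksum big_distrr.
Qed.

(** * Vanishing of all restricted coefficients for a non-integer eigenvalue *)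

Section EigenSpace.

Variables (f : SRvert m n -> algC) (a : algC).
Hypothesis eigen_f : forall x, \sum_y f y * (SRadj y x)%:R = a * f x.
Hypothesis a_nint : a \notin Num.int.

(** The coefficient of t^e in the restriction of P. *)
Definition mass c e : algC := \sum_(y | push c y == e) f y.

Lemma mass_pred c (P : pred {ffun 'I_m -> 'I_n.+1}) :
  (forall e, P e -> mass c e = 0) -> \sum_y f y * (P (push c y))%:R = 0.
Proof.
move=> mass0; rewrite (eq_bigr (fun y => if P (push c y) then f y else 0)); last first.
  by move=> y _; case: ifP; rewrite ?mulr1 ?mulr0.
rewrite -big_mkcond /= (partition_big (push c) P) //= big1 // => e Pe.
rewrite -[RHS](mass0 e Pe); apply: eq_bigl => y.
by case: eqP => [->|]; rewrite ?Pe ?andbF.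
Qed.

(** The coefficient of t^e in the restriction of S_ij P, since S_ij z^y is the sum of z^x over the
    line through [y]. *)
Definition line_mass c e i j : algC :=
  \sum_y f y * (\sum_(x | line i j y x) (push c x == e))%N%:R.

(** The eigenvalue equation is summed over the vertices with block sums [e], using [SRadjE]; the
    number of pairs on the left absorbs the -1 of each S_ij - 1. *)
Lemma mass_eigen c e :
  (a + (\sum_(p : 'I_m * 'I_m | (p.1 < p.2)) 1)%N%:R) * mass c e
  = \sum_(p : 'I_m * 'I_m | (p.1 < p.2)%N) line_mass c e p.1 p.2.
Proof.
have adj_sum: a * mass c e =
    \sum_(p : 'I_m * 'I_m | (p.1 < p.2)%N) (line_mass c e p.1 p.2 - mass c e).
  rewrite mulr_sumr; under eq_bigr do rewrite -eigen_f.
  rewrite exchange_big /= (eq_bigr (fun y => \sum_(p : 'I_m * 'I_m | (p.1 < p.2)%N)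
    f y * \sum_(x | push c x == e) ((line p.1 p.2 y x)%:R - (y == x)%:R))).
    rewrite exchange_big /=; apply: eq_bigr => p _.
    under eq_bigr do rewrite sumrB mulrBr.
    rewrite sumrB; congr (_ - _); last first.
      rewrite /mass [RHS]big_mkcond; apply: eq_bigr => y _.
      case: ifPn => [py|npy].
        rewrite (bigD1 y) //= eqxx big1 ?addr0 ?mulr1 // => x /andP[_ nxy].
        by rewrite eq_sym (negPf nxy).
      rewrite big1 ?mulr0 // => x px; case: eqP => // yx.
      by rewrite yx px in npy.
    apply: eq_bigr => y _; congr (_ * _); rewrite natr_sum big_mkcond [RHS]big_mkcond.
    by apply: eq_bigr => x _; do 2!case: ifP.
  move=> y _; rewrite -!mulr_sumr exchange_big; congr (_ * _).
  by apply: eq_bigr => x _; rewrite SRadjE.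
rewrite mulrDl adj_sum natr_sum mulr_suml -big_split; apply: eq_bigr => p _ /=.
by rewrite mul1r subrK.
Qed.

Lemma line_massC c e i j : line_mass c e i j = line_mass c e j i.
Proof.
by apply: eq_bigr => y _; congr (_ * _%:R); apply: eq_bigl => x; rewrite /line setUC.
Qed.

Lemma line_mass_diff c e i j : (c i < c j)%N ->
    (forall d e', (weight e' < weight e)%N -> mass d e' = 0) ->
    (forall d e', (weight e' <= weight e)%N -> (height d < height c)%N ->
      mass d e' = 0) ->
  line_mass c e i j = 0.
Proof.
move=> lt_c IHw IHh; have neq_c: c i != c j by rewrite -val_eqE ltn_eqF.
have neq_ij: i != j by apply: contraNneq neq_c => ->.
pose P1 e' := same_total e (c i) (c j) e' && (e' (c j) <= e (c j))%N.
pose P2 e' := same_total e (c i) (c j) e' && (e (c i) < e' (c i))%N.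
(* Moving [j] to the smaller colour lowers the height, and [e' (c j) <= e (c j)] keeps the weight
   from growing. *)
have m1: \sum_y f y * (P1 (push (recolor c j (c i)) y))%:R = 0.
  apply: mass_pred => e' /andP[st le_e]; apply: IHh (height_recolor lt_c).
  have := weight_same_total neq_c st; case/andP: st => _ /eqP; nia.
(* Here the height grows, but the strict gain of mass at the smaller colour lowers the weight. *)
have m2: \sum_y f y * (P2 (push (recolor c i (c j)) y))%:R = 0.
  apply: mass_pred => e' /andP[st lt_e]; apply: IHw.
  have := weight_same_total neq_c st; case/andP: st => _ /eqP; nia.
rewrite -[LHS]addr0 -[in LHS]m2 -big_split /= -[RHS]m1; apply: eq_bigr => y _.
by rewrite -mulrDr -natrD (count_line_diff _ _ neq_ij neq_c).
Qed.

(** By induction on weight, then height, pairs of different colours contribute 0. What remains is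
    [mass c e] times [a] plus the number of pairs minus [diag c e], a factor that is nonzero because
    [a] is not an integer. *)
Lemma mass_eq0 c e : mass c e = 0.
Proof.
have [w] := ubnP (weight e); elim: w c e => // w IHw c e.
rewrite ltnS => le_w; have [h] := ubnP (height c).
elim: h c e le_w => // h IHh c e le_w; rewrite ltnS => le_h.
have line0 i j: c i != c j -> line_mass c e i j = 0.
  wlog lt_c: i j / (c i < c j)%N.
    move=> wl neq_c; have := neq_c; rewrite -val_eqE /= neq_ltn => /orP[lt_c|lt_c].
      exact: wl.
    by rewrite line_massC wl // eq_sym.
  move=> _; apply: line_mass_diff => // d e' lt_e; first exact/IHw/(leq_trans lt_e).
  by move=> lt_d; apply: IHh (leq_trans lt_e le_w) (leq_trans lt_d le_h).
have same i j: i != j -> c i == c j ->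
    line_mass c e i j = \sum_(y | push c y == e) f y * (coord y i + coord y j).+1%:R.
  move=> neq_ij /eqP eq_c; rewrite [RHS]big_mkcond; apply: eq_bigr => y _.
  by rewrite count_line_same //; case: (_ == _); rewrite ?muln1 ?muln0 ?mulr0.
have := mass_eigen c e.
rewrite [RHS](bigID (fun p => c p.1 == c p.2)) /= [X in _ = _ + X]big1.
  rewrite addr0 (eq_bigr (fun p => \sum_(y | push c y == e)
      f y * (coord y p.1 + coord y p.2).+1%:R)); last first.
    by move=> p /andP[lt_p eq_p]; apply: same; rewrite // -val_eqE ltn_eqF.
  rewrite exchange_big /= (eq_bigr (fun y => (diag c e)%:R * f y)).
    rewrite -mulr_sumr -/(mass c e) => /eqP; rewrite -subr_eq0 -mulrBl mulf_eq0.
    case/orP=> [|/eqP//]; rewrite -addrA addr_eq0 => /eqP aE; case/negP: a_nint.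
    by rewrite aE rpredN rpredB ?rpred_nat.
  move=> y /eqP eq_y; rewrite -mulr_sumr -natr_sum mulrC; congr (_%:R * _).
  by rewrite -eq_y -sum_same_pairs.
by move=> p /andP[_]; apply: line0.
Qed.

Lemma eigenfun_eq0 y : f y = 0.
Proof.
(* For the identity colouring each class is one coordinate, so the mass at [push c0 y] is the single
   value [f y]. *)
pose c0 : {ffun 'I_m -> 'I_m} := [ffun k => k].
have pushc0 x b: push c0 x b = val x b.
  apply/val_inj; rewrite /= pushE /blocksum (eq_bigl (pred1 b)) ?big_pred1_eq //.
  by move=> k; rewrite ffunE.
have := mass_eq0 c0 (push c0 y); rewrite /mass (big_pred1 y) // => x /=.
apply/eqP/eqP => [eq_x|->//]; apply/val_inj/ffunP => b.
by rewrite -!pushc0 eq_x.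
Qed.

End EigenSpace.

End Vertices.

Theorem theorem1 (m n : nat) (a : algC) :
  eigenvalue (SRadjmx m n) a -> a \in Num.int.
Proof.
case/eigenvalueP => v vA v_neq0; apply: contraNT v_neq0 => a_nint.
pose f (x : SRvert m n) := v 0 (enum_rank x).
apply/eqP/rowP => k; rewrite mxE -[k]enum_valK.
apply: (@eigenfun_eq0 m n f a _ a_nint) => x.
have := congr1 (fun u : 'rV_ _ => u 0 (enum_rank x)) vA; rewrite !mxE => <-.
rewrite [RHS](reindex enum_rank) /=; last exact/onW_bij/enum_rank_bij.
by apply: eq_bigr => y _; rewrite mxE !enum_rankK.
Qed.
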